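(* Let $P(\lambda)=\prod_{j=1}^N\sinh\left(\frac{\lambda-p_j}{2}\right)$ and $Q(\lambda)=\prod_{j=1}^N\sinh\left(\frac{\lambda-q_j}{2}\right)$, where $p_1,\ldots,p_N,q_1,\ldots,q_N\in\mathbb{C}\setminus\bigcup_{i=1}^N\Xi_i$ are pairwise distinct. Let $\kappa,\kappa'\in\mathbb{C}^*$, $\epsilon,\epsilon'\in\{+,-\}$ and $\alpha=\epsilon\epsilon'\kappa'/\kappa$. Then the scalar product $\mathbf{S}(PQ,\alpha)={}_{\mathsf n}\langle P,\kappa,\epsilon\,|\,Q,\kappa',\epsilon'\rangle_{\mathsf n}$ of the two separate states can be expressed as $$\mathbf{S}(PQ,\alpha)=\frac{\det_{1\le i,k\le N}\left[\frac{1}{\sinh(\xi_i-p_k)}+\frac{\alpha\,\tilde f_{P,Q}(\xi_i)}{\sinh(\xi_i-p_k-\eta)}\right]}{\det_{1\le i,k\le N}\left[\frac{1}{\sinh(\xi_i-p_k)}\right]},\qquad \tilde f_{P,Q}(u)=\frac{P(u-\eta+i\pi)}{P(u+i\pi)}\,\frac{Q(u)}{Q(u-\eta)}.$$ If moreover $$\frac{(PQ)(\xi_n-\eta)}{(PQ)(\xi_n)}=\frac{(PQ)(\xi_n-\eta+i\pi)}{(PQ)(\xi_n+i\pi)}\qquad\forall\, n\in\{1,\ldots,N\},$$ then $$\mathbf{S}(PQ,\alpha)=\frac{\det_{N}\left[\mathcal{S}^{(\alpha)}(\mathbf{q}\,|\,\mathbf{p})\right]}{\det_{1\le j,k\le N}\left[\coth\left(\frac{p_k-q_j-\eta}{2}\right)\right]}=\frac{\prod_{i,j=1}^N\sinh\left(\frac{p_i-q_j-\eta}{2}\right)\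 \det_{N}\left[\mathcal{S}^{(\alpha)}(\mathbf{q}\,|\,\mathbf{p})\right]}{\cosh\left(\frac{\sum_{\ell}(p_\ell-q_\ell)-N\eta}{2}\right)\prod_{i<j}\left[\sinh\left(\frac{p_i-p_j}{2}\right)\sinh\left(\frac{q_j-q_i}{2}\right)\right]},$$ where $\mathcal{S}^{(\alpha)}(\mathbf{q}\,|\,\mathbf{p})$ is the $N\times N$ matrix with elements ($1\le j,k\le N$) $$\left[\mathcal{S}^{(\alpha)}(\mathbf{q}\,|\,\mathbf{p})\right]_{j,k}=\coth\left(\frac{p_k-q_j-\eta}{2}\right)+\alpha\,\mathfrak{a}_Q(p_k)\coth\left(\frac{p_k-q_j}{2}\right)-2\alpha\,\frac{d(p_k)}{a(q_j)}\,\frac{Q(q_j+\eta)\,P(q_j+i\pi)}{Q(p_k-\eta)\,P(p_k+i\pi)}\,\frac{1}{\sinh(p_k-q_j)}.$$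
   Context: $N\ge 1$ is an integer; $\eta\in\mathbb{C}$ is not commensurate with $i\pi$; $\xi_1,\ldots,\xi_N\in\mathbb{C}$ are inhomogeneity parameters such that the sets $\Xi_i=\{\xi_i+k\eta+ik'\pi\mid k\in\{0,-1\},\,k'\in\mathbb{Z}\}$ satisfy $\Xi_i\cap\Xi_j=\emptyset$ for $i\ne j$. Set $a(\lambda)=\prod_{n=1}^N\sinh(\lambda-\xi_n+\eta)$, $d(\lambda)=\prod_{n=1}^N\sinh(\lambda-\xi_n)$, $\mathfrak{a}_Q(\lambda)=\frac{d(\lambda)}{a(\lambda)}\frac{Q(\lambda+\eta)}{Q(\lambda-\eta)}$, $\xi_n^{(h)}=\xi_n-h\eta$ for $h\in\{0,1\}$, and $V(x_1,\ldots,x_N)=\prod_{i<j}\sinh(x_j-x_i)$. $(PQ)$ denotes the product function, and $\epsilon,\epsilon'$ are identified with $\pm1$ in formulas. Let $\mathcal H=(\mathbb{C}^2)^{\otimes N}$, with a basis $\{|\mathbf h\rangle\}_{\mathbf h\in\{0,1\}^N}$ of $\mathcal H$ and a basis $\{\langle\mathbf h|\}_{\mathbf h\in\{0,1\}^N}$ of $\mathcal H^*$ (the separation-of-variables bases) satisfying $\langle\mathbf h|\mathbf k\rangle=\delta_{\mathbf h,\mathbf k}/V(\xi_1^{(h_1)},\ldots,\xi_N^{(h_N)})$. The (normalized) separate states are $${}_{\mathsf n}\langle P,\kappa,\epsilon|=\sum_{\mathbf h}\prod_{n=1}^N\left(\frac{\epsilon}{\kappa}\frac{P(\xi_n)}{P(\xi_n-\eta)}\right)^{1-h_n}V(\xi_1^{(h_1)},\ldots,\xi_N^{(h_N)})\,\langle\mathbf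 h|,$$ $$|Q,\kappa',\epsilon'\rangle_{\mathsf n}=\sum_{\mathbf h}\prod_{n=1}^N\left(\epsilon'\kappa'\frac{Q(\xi_n)}{Q(\xi_n-\eta)}\right)^{1-h_n}\frac{V(\xi_1^{(1-h_1)},\ldots,\xi_N^{(1-h_N)})}{V(\xi_1,\ldots,\xi_N)}\,|\mathbf h\rangle.$$ Their scalar product depends only on the function $PQ$ and on $\alpha=\epsilon\epsilon'\kappa'/\kappa$, and is explicitly $$\mathbf S(PQ,\alpha)=\sum_{\mathbf h\in\{0,1\}^N}\prod_{n=1}^N\left[\alpha\,\frac{(PQ)(\xi_n)}{(PQ)(\xi_n-\eta)}\right]^{1-h_n}\frac{V(\xi_1^{(1-h_1)},\ldots,\xi_N^{(1-h_N)})}{V(\xi_1,\ldots,\xi_N)}.$$ The identities are understood for parameters such that no denominator (including the determinants in denominators) vanishes. *)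

(* Defs.v *)
From HB Require Import structures.
From mathcomp Require Import all_boot all_order all_algebra.
From mathcomp Require Import classical_sets reals sequences exp trigo.
From mathcomp Require Import complex.

Set Implicit Arguments.
Unset Strict Implicit.
Unset Printing Implicit Defensive.

Import Order.TTheory GRing.Theory Num.Theory.

Local Open Scope classical_set_scope.
Local Open Scope ring_scope.
Local Open Scope complex_scope.

Section ComplexHyperbolic.
Variable R : realType.
Implicit Types z : R[i].

Definition cexp z : R[i] :=
  (expR (complex.Re z) * cos (complex.Im z))
    +i* (expR (complex.Re z) * sin (complex.Im z)).

Definition csinh z : R[i] := (cexp z - cexp (- z)) / 2.
Definition ccosh z : R[i] := (cexp z + cexp (- z)) / 2.
Definition ccoth z : R[i] := ccosh z / csinh z.

Definition ipi : R[i] := 0 +i* trigo.pi.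

End ComplexHyperbolic.

Arguments ipi {R}.

(* Index set {0,1}^N. A bit coerces to the nat 0 or 1. *)
Definition bits (N : nat) := {ffun 'I_N -> bool}.

(* (C^2)^{\otimes N} in coordinates: N-fold arrays with indices in {0,1}. *)
Notation quantum_space R N := {ffun bits N -> R[i]^o}.
Notation dual_space R N := 'Hom(quantum_space R N, R[i]^o).

Section SeparationOfVariables.
Variables (R : realType) (N : nat).
Implicit Types (eta kappa alpha u : R[i]) (xi x p : 'I_N -> R[i]).
Implicit Types (F P Q : R[i] -> R[i]) (h : bits N).

(* Commensurability is linear dependence over the rationals, so 0 is
   commensurate with i pi. *)
Definition commensurate_ipi eta := exists r : rat, eta = ratr r * ipi.

Definition Xi eta xi (i : 'I_N) : set R[i] :=
  [set z | exists k k' : int, (k = 0 \/ k = -1) /\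
             z = xi i + k%:~R * eta + k'%:~R * ipi].

Definition afun eta xi u : R[i] := \prod_(n < N) csinh (u - xi n + eta).
Definition dfun xi u : R[i] := \prod_(n < N) csinh (u - xi n).

Definition afrak eta xi Q u : R[i] :=
  dfun xi u / afun eta xi u * (Q (u + eta) / Q (u - eta)).

Definition Vdet x : R[i] :=
  \prod_(i < N) \prod_(j < N | (i < j)%N) csinh (x j - x i).

Definition xish eta xi h (n : 'I_N) : R[i] := xi n - (h n)%:R * eta.

Definition flip h : bits N := [ffun n => ~~ h n].

(* The sign of [eps : bool] is [(-1) ^+ eps]: [false] is +, [true] is -. *)
Definition sep_bra eta xi (bra : bits N -> dual_space R N)
    P kappa (eps : bool) : dual_space R N :=
  \sum_(h : bits N)
    ((\prod_(n < N)
        ((-1) ^+ eps / kappa * (P (xi n) / P (xi n - eta))) ^+ (1 - h n))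
      * Vdet (xish eta xi h)) *: bra h.

Definition sep_ket eta xi (ket : bits N -> quantum_space R N)
    Q kappa (eps : bool) : quantum_space R N :=
  \sum_(h : bits N)
    ((\prod_(n < N)
        ((-1) ^+ eps * kappa * (Q (xi n) / Q (xi n - eta))) ^+ (1 - h n))
      * (Vdet (xish eta xi (flip h)) / Vdet xi)) *: ket h.

Definition Ssum eta xi F alpha : R[i] :=
  \sum_(h : bits N)
    (\prod_(n < N) (alpha * (F (xi n) / F (xi n - eta))) ^+ (1 - h n))
      * (Vdet (xish eta xi (flip h)) / Vdet xi).

Definition half_trig_poly p u : R[i] := \prod_(j < N) csinh ((u - p j) / 2).

Definition ftilde eta P Q u : R[i] :=
  P (u - eta + ipi) / P (u + ipi) * (Q u / Q (u - eta)).

Definition Smat eta xi alpha (q p : 'I_N -> R[i]) : 'M[R[i]]_N :=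
  let P := half_trig_poly p in
  let Q := half_trig_poly q in
  \matrix_(j, k)
    (ccoth ((p k - q j - eta) / 2)
     + alpha * afrak eta xi Q (p k) * ccoth ((p k - q j) / 2)
     - 2 * alpha * (dfun xi (p k) / afun eta xi (q j))
         * ((Q (q j + eta) * P (q j + ipi))
            / (Q (p k - eta) * P (p k + ipi)))
         * (1 / csinh (p k - q j))).

End SeparationOfVariables.

(* Main.v *)
(** Expanding the first determinant along its rows, every term is a Cauchy
    determinant [det (1 / csinh (x_i - p_k))], which depends on [x] only through
    [Vdet x] and the product of the denominators; this gives the sum over
    [{0,1}^N]. For the second representation, multiply on the left by a matrix
    [Xmat] built from the values at [xi_i] and [xi_i + i pi] of trigonometric
    polynomials in [u / 2]. By the residue theorem on a strip of width [2 pi]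
    (here Lagrange interpolation), the product with the Cauchy matrix is the coth
    matrix, and, thanks to the quasi-periodicity condition on [PQ], the product
    with the full matrix is [Smat], up to the same diagonal factor on the right. *)

Require Import Defs.
From HB Require Import structures.
From mathcomp Require Import all_boot all_order all_algebra.
From mathcomp Require Import perm ring.
From mathcomp Require Import classical_sets reals sequences exp trigo.
From mathcomp Require Import complex.

Set Implicit Arguments.
Unset Strict Implicit.
Unset Printing Implicit Defensive.

Import Order.TTheory GRing.Theory Num.Theory.

Local Open Scope classical_set_scope.
Local Open Scope ring_scope.

(** * The complex exponential and the zeros of [csinh] *)

Section Exponential.
Variable R : realType.
Implicit Types (z w : R[i]) (x : R).

Lemma sin_natpi n : sin (n%:R * trigo.pi) = 0 :> R.
Proof.
elim: n => [|n IHn]; first by rewrite mul0r sin0.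
by rewrite -natr1 mulrDl mul1r sinDpi IHn oppr0.
Qed.

Lemma sin_intpi (k : int) : sin (k%:~R * trigo.pi) = 0 :> R.
Proof.
case: k => n; first by rewrite -pmulrn sin_natpi.
by rewrite NegzE mulrNz mulNr sinN -pmulrn sin_natpi oppr0.
Qed.

(** Subtracting the multiple of pi given by the floor leaves [y] in [0, pi), where the sine is
    positive except at 0. *)
Lemma sin_eq0_int x : sin x = 0 -> exists k : int, x = k%:~R * trigo.pi.
Proof.
move=> sx0; have pi0 := @pi_gt0 R.
pose k := Num.floor (x / trigo.pi); exists k.
pose y := x - k%:~R * trigo.pi.
have sy0 : sin y = 0 by rewrite sinB sin_intpi sx0 mul0r mulr0 subr0.
have y_ge0 : 0 <= y.
  by rewrite subr_ge0 -ler_pdivlMr // floor_le.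
have y_lt : y < trigo.pi.
  rewrite ltrBlDr -{1}[trigo.pi]mul1r -mulrDl -ltr_pdivrMr //.
  by have := floorD1_gt (x / trigo.pi); rewrite intrD addrC.
apply/eqP; rewrite -subr_eq0; apply: contraTT isT => y_neq0.
have : 0 < sin y by apply: sin_gt0_pi; rewrite lt_neqAle eq_sym y_neq0 y_ge0.
by rewrite sy0 ltxx.
Qed.

Lemma cexpD z w : cexp (z + w) = cexp z * cexp w.
Proof.
case: z w => [a b] [c d]; apply/eqP; rewrite eq_complex /= expRD cosD sinD.
by apply/andP; split; apply/eqP; ring.
Qed.

Lemma cexp0 : cexp 0 = 1 :> R[i].
Proof. by rewrite /cexp /= expR0 cos0 sin0 mulr1 mulr0. Qed.

Lemma cexpNK z : cexp z * cexp (- z) = 1.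
Proof. by rewrite -cexpD subrr cexp0. Qed.

Lemma cexp_neq0 z : cexp z != 0.
Proof.
by apply/eqP => z0; have /eqP := cexpNK z; rewrite z0 mul0r eq_sym oner_eq0.
Qed.

Lemma cexpN z : cexp (- z) = (cexp z)^-1.
Proof. by apply: (mulfI (cexp_neq0 z)); rewrite cexpNK divff ?cexp_neq0. Qed.

Lemma cexpB z w : cexp (z - w) = cexp z / cexp w.
Proof. by rewrite cexpD cexpN. Qed.

Lemma cexp_sum (I : Type) (s : seq I) (P : pred I) (F : I -> R[i]) :
  cexp (\sum_(i <- s | P i) F i) = \prod_(i <- s | P i) cexp (F i).
Proof. exact: (big_morph _ cexpD cexp0). Qed.

Lemma cexp_ipi : cexp ipi = -1 :> R[i].
Proof.
by apply/eqP; rewrite eq_complex /= expR0 cospi sinpi !mul1r oppr0 !eqxx.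
Qed.

Lemma half_add z : z / 2 + z / 2 = z.
Proof. by field. Qed.

Lemma cexp_half z : cexp (z / 2) ^+ 2 = cexp z.
Proof. by rewrite expr2 -cexpD half_add. Qed.

Lemma csinhN z : csinh (- z) = - csinh z.
Proof. by rewrite /csinh opprK -mulNr opprB. Qed.

Lemma csinhDipi z : csinh (z + ipi) = - csinh z.
Proof.
by rewrite /csinh opprD !cexpD !cexpN cexp_ipi invrN1 !mulrN1 -mulNr opprD.
Qed.

Lemma csinh0 : csinh 0 = 0 :> R[i].
Proof. by rewrite /csinh oppr0 subrr mul0r. Qed.

(** Passing to squares of exponentials is what turns the hyperbolic determinants below into rational
    ones. *)
Lemma csinhB z w :
  csinh (z - w) = (cexp z ^+ 2 - cexp w ^+ 2) / (2 * (cexp z * cexp w)).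
Proof.
rewrite /csinh opprB !cexpB; field.
by rewrite !cexp_neq0.
Qed.

Lemma cexp_subX z w :
  cexp z ^+ 2 - cexp w ^+ 2 = 2 * (cexp z * cexp w) * csinh (z - w).
Proof.
by rewrite csinhB mulrC divfK // !mulf_neq0 ?pnatr_eq0 ?cexp_neq0.
Qed.

Lemma ccoshB z w :
  ccosh (z - w) = (cexp z ^+ 2 + cexp w ^+ 2) / (2 * (cexp z * cexp w)).
Proof.
rewrite /ccosh opprB !cexpB; field.
by rewrite !cexp_neq0.
Qed.

Lemma csinh2 z : csinh z = 2 * csinh (z / 2) * ccosh (z / 2).
Proof.
rewrite -[z in LHS]half_add /csinh /ccosh !opprD !cexpD !cexpN; field.
by rewrite cexp_neq0.
Qed.

(** [cexp (ipi / 2)] is the imaginary unit; the proof needs only that its square is -1. Moving [u]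
    by [ipi] moves [u / 2] by [ipi / 2], hence exchanges the two half-angle functions. *)
Lemma csinhD_half z : csinh (z + ipi / 2) = cexp (ipi / 2) * ccosh z.
Proof.
have := cexp_half (@ipi R); rewrite cexp_ipi /csinh /ccosh.
rewrite opprD !cexpD !cexpN; set e := cexp (ipi / 2) => e2.
have -> : e^-1 = - e.
  have e0 : e != 0 by rewrite cexp_neq0.
  by apply: (mulfI e0); rewrite divff // mulrN -expr2 e2 opprK.
by field; rewrite cexp_neq0.
Qed.

Lemma ccoshD_half z : ccosh (z + ipi / 2) = cexp (ipi / 2) * csinh z.
Proof.
have e0 : cexp (ipi / 2) != 0 :> R[i] by rewrite cexp_neq0.
have e2 : cexp (ipi / 2) ^+ 2 = -1 :> R[i] by rewrite cexp_half cexp_ipi.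
apply: (mulfI e0); rewrite -csinhD_half -addrA half_add csinhDipi.
by rewrite mulrA -expr2 e2 mulN1r.
Qed.

(** Here [cexp z] equals [cexp (- z)]. Comparing imaginary parts makes the sine vanish; the cosine
    is then nonzero, and comparing real parts gives [a = 0]. *)
Lemma csinh_eq0 z : csinh z = 0 -> exists k : int, z = k%:~R * ipi.
Proof.
move=> /eqP; rewrite mulf_eq0 invr_eq0 pnatr_eq0 orbF subr_eq0 => /eqP.
case: z => [a b]; rewrite /cexp /= sinN cosN => -[ereal eimag].
have eb a' : expR a' != 0 :> R by rewrite gt_eqF ?expR_gt0.
have sb0 : sin b = 0.
  have /eqP : (expR a + expR (- a)) * sin b = 0 by rewrite mulrDl eimag; ring.
  by rewrite mulf_eq0 gt_eqF ?addr_gt0 ?expR_gt0 //= => /eqP.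
have cb0 : cos b != 0.
  by apply/eqP => cb0; have := cos2Dsin2 b; rewrite cb0 sb0 expr0n addr0 => /eqP;
     rewrite eq_sym oner_eq0.
have a0 : a = 0.
  have /expR_inj/eqP := mulIf cb0 ereal.
  by rewrite -addr_eq0 -mulr2n mulrn_eq0 => /eqP.
have [k ->] := sin_eq0_int sb0; exists k.
have -> : k%:~R = (k%:~R : R)%:C%C :> R[i] by rewrite rmorph_int.
by rewrite a0; apply/eqP; rewrite eq_complex /= !mul0r !mulr0 subr0 addr0 !eqxx.
Qed.

End Exponential.

(** * Lagrange interpolation and rational Cauchy determinants *)

Section RationalIdentities.
Variable F : fieldType.

(* The left-hand side is the coefficient of degree [#|T| - 1] of the Lagrange
   interpolant of [f], which is [f] itself. *)
Lemma lagrange_sum0 (T : finType) (y : T -> F) (f : {poly F}) :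
    injective y -> (size f < #|T|)%N ->
  \sum_t f.[y t] / \prod_(l | l != t) (y t - y l) = 0.
Proof.
move=> y_inj szf; pose w t := \prod_(l | l != t) (y t - y l).
pose ell t : {poly F} := \prod_(l | l != t) ('X - (y l)%:P).
have w0 t : w t != 0.
  by apply/prodf_neq0 => l ll; rewrite subr_eq0 (inj_eq y_inj) eq_sym.
have szell t : size (ell t) = #|T|.
  rewrite /ell -big_filter; case: big_enumP => e _ _ [_ size_e].
  rewrite size_prod_XsubC size_e cardC1.
  by rewrite prednK // (cardD1 t).
have monic_ell t : ell t \is monic by rewrite monic_prod_XsubC.
have ellE s t : (ell t).[y s] = if s == t then w t else 0.
  rewrite /ell horner_prod; case: eqP => [->|/eqP st].
    by apply: eq_bigr => l _; rewrite hornerXsubC.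
  by rewrite (bigD1 s) //= hornerXsubC subrr mul0r.
pose L := \sum_t (f.[y t] / w t) *: ell t.
have Ly s : L.[y s] = f.[y s].
  rewrite horner_sum (bigD1 s) //= big1 => [|t ts]; rewrite hornerZ ellE.
    by rewrite eqxx addr0 mulfVK.
  by rewrite eq_sym (negPf ts) mulr0.
have szL : (size L <= #|T|)%N.
  apply: (leq_trans (size_sum _ _ _)); apply/bigmax_leqP => t _.
  by rewrite -(szell t) size_scale_leq.
have LE : L = f.
  apply/eqP; rewrite -subr_eq0; apply/eqP/(@roots_geq_poly_eq0 _ _ (map y (enum T))).
  - by apply/allP => _ /mapP[s _ ->]; rewrite rootE !hornerE Ly subrr.
  - by rewrite map_inj_uniq ?enum_uniq.
  - rewrite size_map -cardE (leq_trans (size_polyD _ _)) // geq_max szL.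
    by rewrite size_polyN ltnW.
have : L`_(#|T|.-1) = 0.
  by rewrite LE nth_default // -ltnS (leq_trans szf) // leqSpred.
rewrite coef_sum => sum0; rewrite -[RHS]sum0; apply: eq_bigr => t _.
by rewrite coefZ -(szell t) -/(lead_coef _) (monicP _) ?mulr1.
Qed.

Lemma prod_neqE (n : nat) (R : comNzRingType) (g : 'I_n -> 'I_n -> R) :
  \prod_i \prod_(j | j != i) g i j =
  \prod_(i < n) \prod_(j < n | (i < j)%N) (g i j * g j i).
Proof.
under [RHS]eq_bigr do rewrite big_split /=.
rewrite big_split /= [X in _ = _ * X](exchange_big_dep predT) //= -big_split /=.
apply: eq_bigr => i _; rewrite (bigID (fun j : 'I_n => (i < j)%N)) /=.
by congr (_ * _); apply: eq_bigl => j; rewrite -val_eqE neq_ltn;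
   case: (ltngtP i j).
Qed.

Lemma prod_splitE (n : nat) (R : comNzRingType) (g : 'I_n -> 'I_n -> R) :
  \prod_i \prod_j g i j =
  (\prod_i g i i) *
  \prod_(i < n) \prod_(j < n | (i < j)%N) (g i j * g j i).
Proof.
by rewrite -prod_neqE -big_split; apply: eq_bigr => i _; rewrite (bigD1 i).
Qed.


(* The polynomials [('X - tY_j) \prod_(l != j) ('X - Y_l)] are monic and share
   the constant term [tau], so they lie in the span of ['X], ..., ['X^n] and
   ['X^(n.+1) + tau]; only the change of basis depends on [X]. *)
Lemma det_cauchy_factor n (Y : 'I_n.+1 -> F) (t : F) :
  exists c, forall X : 'I_n.+1 -> F,
    \det (\matrix_(k, j) ((X k - t * Y j) * \prod_(l | l != j) (X k - Y l))) =
    c * \prod_(i < n.+1) \prod_(j < n.+1 | (i < j)%N) (X j - X i)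
      * (\prod_i X i - t * \prod_i Y i).
Proof.
pose m j : {poly F} := ('X - (t * Y j)%:P) * \prod_(l | l != j) ('X - (Y l)%:P).
pose tau := t * (-1) ^+ n.+1 * \prod_i Y i.
have monic_m j : m j \is monic by rewrite monicMr ?monicXsubC ?monic_prod_XsubC.
have size_m j : size (m j) = n.+2.
  rewrite size_Mmonic ?polyXsubC_eq0 ?monic_prod_XsubC // size_XsubC /=.
  rewrite -big_filter; case: big_enumP => e _ _ [_ size_e].
  by rewrite size_prod_XsubC size_e cardC1 card_ord.
have m0 j : (m j)`_0 = tau.
  rewrite -horner_coef0 hornerM hornerXsubC horner_prod.
  under eq_bigr do rewrite hornerXsubC sub0r.
  rewrite sub0r prodrN cardC1 card_ord /tau [in RHS](bigD1 j) //= exprS.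
  by ring.
(* Column [j] holds the coordinates of [m j] on ['X^(n.+1) + tau] (row [ord0]) and on the powers of
   degree 1 to [n]. *)
pose K : 'M_n.+1 := \matrix_(i, j) (if i == ord0 then 1 else (m j)`_i).
exists ((-1) ^+ n * \det K) => X.
pose chi : {poly F} := \prod_l ('X - (X l)%:P).
have size_chi : size chi = n.+2 by rewrite /chi -big_enum /= size_prod_XsubC size_enum_ord.
have monic_chi : chi \is monic by rewrite monic_prod_XsubC.
have chi0 : chi`_0 = (-1) ^+ n.+1 * \prod_i X i.
  rewrite -horner_coef0 horner_prod.
  under eq_bigr do rewrite hornerXsubC sub0r.
  by rewrite prodrN card_ord.
(* [X k] is a root of [chi], so its power [n.+1] reduces to lower powers; this fills column [ord0].
   [U] is triangular with diagonal 1 except for [tau] minus the constant term of [chi], the source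
   of the last factor of the formula. *)
pose U : 'M_n.+1 :=
  \matrix_(l, i) (if i == ord0 then tau *+ (l == ord0) - chi`_l else (l == i)%:R).
pose V := Vandermonde n.+1 (\row_l X l).
have VU k i : (V^T *m U) k i = if i == ord0 then X k ^+ n.+1 + tau else X k ^+ i.
  rewrite mxE; case: eqP => [->|/eqP i0].
    have chiX : chi.[X k] = 0 by rewrite horner_prod (bigD1 k) //= hornerXsubC subrr mul0r.
    rewrite (horner_coef_wide _ (_ : _ <= n.+2)%N) ?size_chi // in chiX.
    rewrite big_ord_recr /= in chiX.
    have chin : chi`_n.+1 = 1 by rewrite -(monicP monic_chi) /lead_coef size_chi.
    rewrite chin mul1r in chiX.
    transitivity (\sum_(l < n.+1) (X k ^+ l * tau *+ (l == ord0) - chi`_l * X k ^+ l)).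
      by apply: eq_bigr => l _; rewrite !mxE eqxx mulrBr mulrnAr [chi`_l * _]mulrC.
    rewrite sumrB (bigD1 ord0) //= ?eqxx ?expr0 ?mul1r ?mulr1n big1 => [|l /negPf ->].
      by rewrite addr0 addrC; move/addr0_eq: chiX => <-.
    by rewrite mulr0n.
  rewrite (bigD1 i) //= !mxE (negPf i0) eqxx mulr1 big1 ?addr0 // => l li.
  by rewrite !mxE (negPf i0) (negPf li) mulr0.
have -> : \matrix_(k, j) ((X k - t * Y j) * \prod_(l | l != j) (X k - Y l)) =
          V^T *m U *m K.
  apply/matrixP => k j; rewrite !mxE.
  transitivity (m j).[X k].
    by rewrite hornerM hornerXsubC horner_prod; congr (_ * _);
       apply: eq_bigr => l _; rewrite hornerXsubC.
  rewrite (horner_coef_wide _ (_ : _ <= n.+2)%N) ?size_m //.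
  rewrite big_ord_recr big_ord_recl /= m0 expr0 mulr1.
  have -> : (m j)`_n.+1 = 1 by rewrite -(monicP (monic_m j)) /lead_coef size_m.
  rewrite mul1r.
  rewrite [RHS]big_ord_recl VU !mxE eqxx mulr1 [LHS]addrAC; congr (_ + _).
    by rewrite addrC.
  by apply: eq_bigr => i _; rewrite VU !mxE /= mulrC.
have detV : \det V = \prod_(i < n.+1) \prod_(j < n.+1 | (i < j)%N) (X j - X i).
  rewrite det_Vandermonde; apply: eq_bigr => i _.
  by apply: eq_bigr => j _; rewrite !mxE.
have dU : \prod_i U i i = tau - chi`_0.
  rewrite big_ord_recl big1 => [|i _]; first by rewrite mxE mulr1 /= mulr1n.
  by rewrite mxE /= eqxx.
rewrite !det_mulmx det_tr detV det_trig; last first.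
  apply/is_trig_mxP => i j ij; rewrite mxE -!val_eqE /=.
  by rewrite (gtn_eqF (leq_ltn_trans (leq0n _) ij)) (ltn_eqF ij).
rewrite dU chi0 /tau exprS; ring.
Qed.

(** Clearing the row denominators gives [det_cauchy_factor] at [t = -1]; its constant is found by
    specializing [X] to [Y]. *)
Lemma det_cauchy_sum n (X Y : 'I_n.+1 -> F) :
    (2 : F) != 0 -> (forall i, Y i != 0) -> injective Y ->
    (forall i j, X i != Y j) ->
  \det (\matrix_(k, j) ((X k + Y j) / (X k - Y j)))
    * \prod_k \prod_j (X k - Y j) =
  2 ^+ n * (\prod_i X i + \prod_i Y i)
    * \prod_(i < n.+1) \prod_(j < n.+1 | (i < j)%N) ((X j - X i) * (Y i - Y j)).
Proof.
move=> two0 Y0 Y_inj XY.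
have [c cE] := det_cauchy_factor Y (-1).
pose vY := \prod_(i < n.+1) \prod_(j < n.+1 | (i < j)%N) (Y j - Y i).
pose vY' := \prod_(i < n.+1) \prod_(j < n.+1 | (i < j)%N) (Y i - Y j).
have vY0 : vY != 0.
  apply/prodf_neq0 => i _; apply/prodf_neq0 => j ij.
  by rewrite subr_eq0 (inj_eq Y_inj) -val_eqE gtn_eqF.
have pY0 : \prod_i Y i != 0 by apply/prodf_neq0.
have cY : c = 2 ^+ n * vY'.
  have := cE Y; rewrite -/vY mulN1r opprK.
  (* At [X = Y] every off-diagonal entry contains a zero factor. *)
  have -> : \matrix_(k, j) ((Y k - -1 * Y j) * \prod_(l | l != j) (Y k - Y l)) =
      diag_mx (\row_j (2 * Y j * \prod_(l | l != j) (Y j - Y l))).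
    apply/matrixP => k j; rewrite !mxE; case: (eqVneq k j) => [->|kj].
      by rewrite mulN1r opprK mulr1n; ring.
    by rewrite mulr0n (bigD1 k) //= subrr mul0r mulr0.
  rewrite det_diag; under eq_bigr do rewrite mxE.
  rewrite !big_split /= prodr_const card_ord prod_neqE.
  under [X in _ * X]eq_bigr do rewrite big_split /=.
  rewrite big_split /= -/vY -/vY' exprS => e.
  apply: (mulIf vY0); apply: (mulIf pY0); apply: (mulIf two0).
  transitivity (c * vY * (\prod_i Y i + \prod_i Y i)); first by ring.
  by rewrite -e; ring.
have -> : \matrix_(k, j) ((X k + Y j) / (X k - Y j)) =
    diag_mx (\row_k (\prod_j (X k - Y j))^-1) *m
    \matrix_(k, j) ((X k - -1 * Y j) * \prod_(l | l != j) (X k - Y l)).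
  apply/matrixP => k j; rewrite mul_diag_mx !mxE mulN1r opprK.
  have nz l : X k - Y l != 0 by rewrite subr_eq0.
  rewrite [in RHS](bigD1 j) //=; field.
  by rewrite nz andbT; apply/prodf_neq0.
rewrite det_mulmx det_diag cE cY mulN1r opprK.
under eq_bigr do rewrite mxE.
rewrite prodfV mulrAC mulVf ?mul1r.
  rewrite (eq_bigr _ (fun i _ => big_split _ _ _ _ _)) big_split /= -/vY'.
  by ring.
by apply/prodf_neq0 => k _; apply/prodf_neq0 => j _; rewrite subr_eq0.
Qed.

End RationalIdentities.

(** * Trigonometric polynomials in [u / 2] and sums of residues *)

Section TrigonometricPolynomials.
Variable R : realType.
Implicit Types (f g : R[i] -> R[i]) (u a b : R[i]).

(** Trigonometric polynomials of degree at most [m] in [u / 2]: combinations of [cexp (k * u / 2)]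
    with [k] between [-m] and [m] and of the parity of [m]. The factor [cexp (u / 2) ^+ m] leaves a
    polynomial in [cexp u]. *)
Definition half_trig m g := exists p : {poly R[i]},
  (size p <= m.+1)%N /\ forall u, g u * cexp (u / 2) ^+ m = p.[cexp u].

Lemma half_trig_csinh a : half_trig 1 (fun u => csinh ((u + a) / 2)).
Proof.
exists ((2 * cexp (- a / 2))^-1 *: ('X - (cexp (- a))%:P)); split=> [|u].
  by rewrite (leq_trans (size_scale_leq _ _)) // size_XsubC.
have -> : (u + a) / 2 = u / 2 - (- a) / 2 by ring.
rewrite csinhB !cexp_half hornerZ hornerXsubC; field.
by rewrite !cexp_neq0.
Qed.

Lemma half_trigM m n f g :
  half_trig m f -> half_trig n g -> half_trig (m + n) (fun u => f u * g u).
Proof.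
move=> [p [szp pE]] [q [szq qE]]; exists (p * q); split=> [|u].
  apply: (leq_trans (size_polyMleq _ _)).
  by rewrite -subn1 leq_subLR add1n (leq_trans (leq_add szp szq)) // addSn addnS.
by rewrite hornerM -pE -qE exprD; ring.
Qed.

Lemma half_trigZ m a g : half_trig m g -> half_trig m (fun u => a * g u).
Proof.
move=> [p [szp pE]]; exists (a *: p); split=> [|u].
  exact: leq_trans (size_scale_leq _ _) szp.
by rewrite hornerZ -pE mulrA.
Qed.

Lemma eq_half_trig m f g : f =1 g -> half_trig m f -> half_trig m g.
Proof. by move=> fg [p [szp pE]]; exists p; split=> // u; rewrite -fg. Qed.

Lemma half_trig_ccosh a : half_trig 1 (fun u => ccosh ((u + a) / 2)).
Proof.
apply: (@eq_half_trig _
  (fun u => (cexp (ipi / 2))^-1 * csinh ((u + (a + ipi)) / 2))) => [u|].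
  have -> : (u + (a + ipi)) / 2 = (u + a) / 2 + ipi / 2 by ring.
  by rewrite csinhD_half mulKf ?cexp_neq0.
exact/half_trigZ/half_trig_csinh.
Qed.

Lemma half_trig_prod (n : nat) (f : 'I_n -> R[i] -> R[i]) :
  (forall i, half_trig 1 (f i)) -> half_trig n (fun u => \prod_i f i u).
Proof.
elim: n f => [|n IHn] f hf.
  by exists 1; rewrite size_poly1; split=> // u; rewrite big_ord0 mulr1 hornerC.
apply: (@eq_half_trig _ (fun u => f ord0 u * \prod_i f (lift ord0 i) u)) => [u|].
  by rewrite big_ord_recl.
exact: (half_trigM (hf ord0) (IHn (fun i => f (lift ord0 i)) (fun i => hf _))).
Qed.

(* The residues of [g u / \prod_t csinh (u - y t)] on a strip of width [2 pi]
   sum to zero. Pairing the poles [y t] and [y t + ipi] leaves the odd part of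
   the polynomial representing [g], to which Lagrange interpolation at the nodes
   [cexp (2 * y t)] applies. *)
Lemma sum_residues (T : finType) (y : T -> R[i]) m g :
    (forall s t, s != t -> csinh (y s - y t) != 0) ->
    half_trig m g -> m.+2 = #|T|.*2 ->
  \sum_t (g (y t) + (-1) ^+ #|T| * g (y t + ipi))
           / \prod_(l | l != t) csinh (y t - y l) = 0.
Proof.
move=> y_sep [p [szp pE]] mT; set n := #|T|.
pose r := odd_poly p.
have n0 : (0 < n)%N by rewrite -double_gt0 -mT.
(* [p] has degree at most [2n - 2], so its odd part has at most [n - 1] coefficients, fewer than
   there are nodes. *)
have szr : (size r < n)%N.
  have szp2 : (size p <= (n.-1).*2.+1)%N.
    by rewrite -ltnS (leq_ltn_trans szp) // -doubleS prednK // -mT.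
  apply: (leq_ltn_trans (size_odd_poly p)); rewrite -(prednK n0) ltnS.
  by have := half_leq szp2; rewrite [(_.+1)./2]uphalf_double.
have mE : m = (n.-1).*2 by apply/eqP; rewrite -2!eqSS mT -/n -{1}(prednK n0).
(* Shifting [u] by [ipi] negates [cexp u], so the two values of [g] combine into the difference of
   [p] at opposite points. *)
have gE u : (g u + (-1) ^+ n * g (u + ipi)) * cexp u ^+ n =
            2 * (cexp u ^+ 2 * r.[cexp u ^+ 2]).
  have pu v : p.[cexp v] = g v * cexp v ^+ n.-1.
    by rewrite -pE mE -muln2 mulnC exprM cexp_half.
  have := pu (u + ipi); rewrite cexpD cexp_ipi mulrN1 => pN.
  have oddE v : p.[v] - p.[- v] = 2 * (v * r.[v ^+ 2]).
    rewrite -[in LHS](poly_even_odd p) !(hornerD, hornerM, hornerX).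
    rewrite !horner_comp !hornerXn sqrrN /r; ring.
  transitivity (cexp u * (p.[cexp u] - p.[- cexp u])); last first.
    by rewrite oddE; ring.
  rewrite pN pu -(prednK n0) /= !exprS [(- cexp u) ^+ _]exprNn; ring.
have Y_inj : injective (fun t => cexp (y t) ^+ 2).
  move=> s t eY; apply/eqP; apply: contraTT isT => /y_sep st.
  suff : cexp (y s) ^+ 2 - cexp (y t) ^+ 2 != 0 by rewrite eY subrr eqxx.
  by rewrite cexp_subX; apply: mulf_neq0 st; rewrite !mulf_neq0 ?pnatr_eq0 ?cexp_neq0.
have := lagrange_sum0 Y_inj szr.
(* Together with a power of [cexp (y t)], this constant converts the differences of squares into
   values of [csinh]. *)
move/(congr1 ( *%R (2 ^+ n * \prod_l cexp (y l)))); rewrite mulr0 => sum0.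
rewrite -[RHS]sum0 mulr_sumr; apply: eq_bigr => t _.
have e0 := cexp_neq0 (y t).
have s0 : \prod_(l | l != t) csinh (y t - y l) != 0.
  by apply/prodf_neq0 => l lt; rewrite y_sep // eq_sym.
have -> : g (y t) + (-1) ^+ n * g (y t + ipi) =
    2 * (cexp (y t) ^+ 2 * r.[cexp (y t) ^+ 2]) / cexp (y t) ^+ n.
  by rewrite -gE mulfK // expf_neq0.
under [X in _ = _ * (_ / X)]eq_bigr do rewrite /= cexp_subX.
rewrite /= 3![in RHS]big_split /= !prodr_const cardC1 -/n [\prod_l _](bigD1 t) //=.
rewrite -(prednK n0) /= !exprS.
move: (\prod_(l | l != t) csinh (y t - y l)) s0 => S s0; field.
rewrite s0 e0 !expf_neq0 ?pnatr_eq0 ?andbT //=.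
by apply/prodf_neq0 => l _; rewrite cexp_neq0.
Qed.

(** The residue sums run over the [xi i] with one or two extra poles adjoined through [option]; this
    lemma and the next two separate the extra poles. *)
Lemma big_option_neq (T : finType) (t : T) (A : Type) (idx : A)
    (op : Monoid.com_law idx) (G : option T -> A) :
  \big[op/idx]_(o | o != Some t) G o =
  op (G None) (\big[op/idx]_(l | l != t) G (Some l)).
Proof.
rewrite (bigD1 None) //=; congr (op _ _).
by rewrite (reindex_omap Some id) => [|[o|] //]; apply: eq_bigl => l;
   rewrite /= eqxx !andbT.
Qed.

Lemma big_option (T : finType) (A : Type) (idx : A)
    (op : Monoid.com_law idx) (G : option T -> A) :
  \big[op/idx]_o G o = op (G None) (\big[op/idx]_l G (Some l)).
Proof.
rewrite (bigD1 None) //=; congr (op _ _).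
by rewrite (reindex_omap Some id) => [|[o|] //]; apply: eq_bigl => l;
   rewrite /= eqxx.
Qed.

Lemma big_option_neqNone (T : finType) (A : Type) (idx : A)
    (op : Monoid.com_law idx) (G : option T -> A) :
  \big[op/idx]_(o | o != None) G o = \big[op/idx]_l G (Some l).
Proof.
by rewrite (reindex_omap Some id) => [|[o|] //]; apply: eq_bigl => l;
   rewrite /= eqxx.
Qed.

End TrigonometricPolynomials.

(** * Products of differences of squared exponentials as products of [csinh] *)

Section HyperbolicProducts.
Variables (R : realType) (N : nat).
Implicit Types (x y : 'I_N -> R[i]).

Lemma prod_ltM_neq0 (T : fieldType) (g : 'I_N -> 'I_N -> T) :
  (forall i j, g i j != 0) ->
  \prod_(i < N) \prod_(j < N | (i < j)%N) g i j != 0.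
Proof. by move=> g0; apply/prodf_neq0 => i _; apply/prodf_neq0. Qed.

Lemma prod_lt_csinh x :
  \prod_(i < N) \prod_(j < N | (i < j)%N) (cexp (x j) ^+ 2 - cexp (x i) ^+ 2) =
  \prod_(i < N) \prod_(j < N | (i < j)%N) (2 * (cexp (x i) * cexp (x j)))
    * Vdet x.
Proof.
rewrite -big_split; apply: eq_bigr => i _ /=.
rewrite -big_split; apply: eq_bigr => j _ /=.
by rewrite cexp_subX [cexp (x j) * _]mulrC.
Qed.

(** Regrouping the pairs [(i, j)] and [(j, i)] separates the exponential prefactor into factors in
    [x] alone and in [y] alone. *)
Lemma prod_cexp_csinh x y :
  \prod_k \prod_j (cexp (x k) ^+ 2 - cexp (y j) ^+ 2) =
  (2 ^+ N * \prod_i cexp (x i) * \prod_i cexp (y i))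
  * \prod_(i < N) \prod_(j < N | (i < j)%N) (2 * (cexp (x i) * cexp (x j)))
  * \prod_(i < N) \prod_(j < N | (i < j)%N) (2 * (cexp (y i) * cexp (y j)))
  * \prod_k \prod_j csinh (x k - y j).
Proof.
have -> : \prod_k \prod_j (cexp (x k) ^+ 2 - cexp (y j) ^+ 2) =
    \prod_k \prod_j (2 * (cexp (x k) * cexp (y j)))
    * \prod_k \prod_j csinh (x k - y j).
  rewrite -big_split; apply: eq_bigr => k _ /=.
  rewrite -big_split; apply: eq_bigr => j _ /=.
  by rewrite cexp_subX.
congr (_ * _); rewrite prod_splitE big_split prodr_const card_ord big_split /=.
rewrite -[RHS]mulrA !mulrA -!mulrA; congr (_ * (_ * (_ * _))).
rewrite -big_split; apply: eq_bigr => i _ /=.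
by rewrite -big_split; apply: eq_bigr => j _ /=; ring.
Qed.

End HyperbolicProducts.

(** * Cauchy and coth determinants in hyperbolic form *)

Section HyperbolicDeterminants.
Variables (R : realType) (N : nat).
Implicit Types (x y : 'I_N -> R[i]).

(** This is [det_cauchy_factor] at [t = 0] in the squared exponentials. The constant stays implicit:
    since it does not depend on [x], it drops out when two such determinants are compared. *)
Lemma det_cauchy_csinh y : exists c, forall x,
    (forall i j, csinh (x i - y j) != 0) ->
  \det (\matrix_(i, k) (1 / csinh (x i - y k)))
    * \prod_i \prod_k csinh (x i - y k) = c * Vdet x.
Proof.
case: N y => [|n] y.
  by exists 1 => x _; rewrite det_mx00 /Vdet !big_ord0 !mulr1.
have [c cE] := det_cauchy_factor (fun j => cexp (y j) ^+ 2) 0.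
set VY := \prod_(i < n.+1) \prod_(j < n.+1 | (i < j)%N) (2 * (cexp (y i) * cexp (y j))).
exists (c / VY) => x xy.
have VY0 : VY != 0.
  by apply: prod_ltM_neq0 => i j; rewrite !mulf_neq0 ?pnatr_eq0 ?cexp_neq0.
have prodX := prod_cexp_csinh x y; have ltX := prod_lt_csinh x.
move: (cE (fun j => cexp (x j) ^+ 2)); rewrite ltX => {}cE.
set VX := \prod_(i < n.+1) \prod_(j < n.+1 | (i < j)%N) (2 * (cexp (x i) * cexp (x j))) in prodX cE.
have VX0 : VX != 0.
  by apply: prod_ltM_neq0 => i j; rewrite !mulf_neq0 ?pnatr_eq0 ?cexp_neq0.
have X0 k l : cexp (x k) ^+ 2 - cexp (y l) ^+ 2 != 0.
  by rewrite cexp_subX; apply: mulf_neq0 (xy _ _); rewrite !mulf_neq0 ?pnatr_eq0 ?cexp_neq0.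
(* At [t = 0] row [k] carries [cexp (x k) ^+ 2], while [csinhB] asks for the first power; hence the
   division by [cexp (x k)]. *)
have -> : \matrix_(i, k) (1 / csinh (x i - y k)) =
    diag_mx (\row_k (2 / cexp (x k) / \prod_l (cexp (x k) ^+ 2 - cexp (y l) ^+ 2)))
    *m \matrix_(k, j) ((cexp (x k) ^+ 2 - 0 * cexp (y j) ^+ 2)
         * \prod_(l | l != j) (cexp (x k) ^+ 2 - cexp (y l) ^+ 2))
    *m diag_mx (\row_j cexp (y j)).
  apply/matrixP => k j; rewrite mul_mx_diag mxE mul_diag_mx !mxE mul0r subr0.
  rewrite csinhB [in RHS](bigD1 j) //=; move: (X0 k j).
  have : \prod_(l | l != j) (cexp (x k) ^+ 2 - cexp (y l) ^+ 2) != 0.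
    by apply/prodf_neq0.
  move: (\prod_(l | _) _) => D D0 X0kj; field.
  by rewrite !cexp_neq0 X0kj D0.
have detE (f : 'I_n.+1 -> R[i]) : \det (diag_mx (\row_k f k)) = \prod_k f k.
  by rewrite det_diag; apply: eq_bigr => k _; rewrite mxE.
rewrite !det_mulmx !detE cE mul0r subr0.
rewrite big_split /= prodfV prodX big_split /= prodr_const card_ord prodfV.
rewrite prodrXl.
have P0 : \prod_k \prod_j csinh (x k - y j) != 0.
  by apply/prodf_neq0 => k _; apply/prodf_neq0.
have xP0 : \prod_k cexp (x k) != 0 by apply/prodf_neq0 => k _; rewrite cexp_neq0.
have yP0 : \prod_k cexp (y k) != 0 by apply/prodf_neq0 => k _; rewrite cexp_neq0.
have t0 : 2 ^+ n.+1 != 0 :> R[i] by rewrite expf_neq0 ?pnatr_eq0.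
rewrite -/VY.
move: (2 ^+ n.+1) (\prod_k \prod_j csinh (x k - y j)) (\prod_k cexp (x k))
  (\prod_k cexp (y k)) (Vdet x) P0 xP0 yP0 t0 => T PP PX PY Vx P0 xP0 yP0 t0.
by field; rewrite VX0 VY0 P0 xP0 yP0 t0.
Qed.

(** In squared exponentials [X] and [Y], [ccoth (x - y)] is [(X + Y) / (X - Y)], so [det_cauchy_sum]
    applies; its sum of two products becomes the [ccosh]. *)
Lemma det_ccoth x y :
    (0 < N)%N -> (forall i j, csinh (x i - y j) != 0) ->
    (forall i j : 'I_N, (i < j)%N -> csinh (y j - y i) != 0) ->
  \det (\matrix_(k, j) ccoth (x k - y j))
    * \prod_k \prod_j csinh (x k - y j) =
  ccosh (\sum_i x i - \sum_i y i)
    * \prod_(i < N) \prod_(j < N | (i < j)%N)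
        (csinh (x i - x j) * csinh (y j - y i)).
Proof.
case: N x y => [//|n] x y _ xy yy.
have two0 : (2 : R[i]) != 0 by rewrite pnatr_eq0.
have ee (z w : R[i]) : 2 * (cexp z * cexp w) != 0 by rewrite !mulf_neq0 ?cexp_neq0.
have Y0 i : cexp (y i) ^+ 2 != 0 by rewrite expf_neq0 ?cexp_neq0.
have XY i j : cexp (x i) ^+ 2 != cexp (y j) ^+ 2.
  by rewrite -subr_eq0 cexp_subX; apply: mulf_neq0 (ee _ _) (xy _ _).
have Y_lt (i j : 'I_n.+1) : (i < j)%N -> cexp (y j) ^+ 2 != cexp (y i) ^+ 2.
  by move=> ij; rewrite -subr_eq0 cexp_subX; apply: mulf_neq0 (ee _ _) (yy _ _ ij).
have Y_inj : injective (fun j => cexp (y j) ^+ 2).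
  move=> i j eY; apply/val_inj; case: (ltngtP i j) => // /Y_lt; by rewrite eY eqxx.
have := det_cauchy_sum two0 Y0 Y_inj XY.
have -> : \matrix_(k, j) ((cexp (x k) ^+ 2 + cexp (y j) ^+ 2)
                         / (cexp (x k) ^+ 2 - cexp (y j) ^+ 2)) =
          \matrix_(k, j) ccoth (x k - y j).
  apply/matrixP => k j; rewrite !mxE /ccoth csinhB ccoshB.
  have := XY k j; rewrite -subr_eq0 => XY0; field.
  by rewrite XY0 !cexp_neq0.
rewrite prod_cexp_csinh => e.
pose VX := \prod_(i < n.+1) \prod_(j < n.+1 | (i < j)%N) (2 * (cexp (x i) * cexp (x j))).
pose VY := \prod_(i < n.+1) \prod_(j < n.+1 | (i < j)%N) (2 * (cexp (y i) * cexp (y j))).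
have VX0 : VX != 0 by apply: prod_ltM_neq0.
have VY0 : VY != 0 by apply: prod_ltM_neq0.
pose PX := \prod_i cexp (x i); pose PY := \prod_i cexp (y i).
have PX0 : PX != 0 by apply/prodf_neq0 => k _; rewrite cexp_neq0.
have PY0 : PY != 0 by apply/prodf_neq0 => k _; rewrite cexp_neq0.
have t0 : 2 ^+ n.+1 != 0 :> R[i] by rewrite expf_neq0.
have c0 : 2 ^+ n.+1 * PX * PY * VX * VY != 0 by rewrite !mulf_neq0.
apply: (mulfI c0); rewrite -/PX -/PY -/VX -/VY in e.
rewrite mulrCA e.
have -> : \prod_i cexp (x i) ^+ 2 + \prod_i cexp (y i) ^+ 2 =
    2 * (PX * PY) * ccosh (\sum_i x i - \sum_i y i).
  by rewrite ccoshB !cexp_sum -/PX -/PY -!prodrXl -/PX -/PY; field; rewrite PX0 PY0.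
have -> : \prod_(i < n.+1) \prod_(j < n.+1 | (i < j)%N)
     ((cexp (x j) ^+ 2 - cexp (x i) ^+ 2) * (cexp (y i) ^+ 2 - cexp (y j) ^+ 2)) =
   VX * VY * \prod_(i < n.+1) \prod_(j < n.+1 | (i < j)%N)
        (csinh (x i - x j) * csinh (y j - y i)).
  rewrite -!big_split; apply: eq_bigr => i _ /=.
  rewrite -!big_split; apply: eq_bigr => j _ /=.
  rewrite !cexp_subX -(opprB (x i)) -(opprB (y j)) !csinhN.
  by ring.
by rewrite exprS; ring.
Qed.

End HyperbolicDeterminants.

(** Multilinearity in the rows, obtained by distributing the product in each Leibniz term. A true
    bit selects [A], in accordance with the exponents [1 - h n] of [Ssum]. *)
Lemma det_addmx_rows (K : comNzRingType) (N : nat) (A B : 'I_N -> 'I_N -> K) :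
  \det (\matrix_(i, k) (A i k + B i k)) =
  \sum_(h : bits N) \det (\matrix_(i, k) if h i then A i k else B i k).
Proof.
rewrite [RHS]exchange_big /=; apply: eq_bigr => s _.
under eq_bigr do rewrite mxE.
rewrite -mulr_sumr; congr (_ * _).
rewrite (_ : \prod_i _ = \prod_i \sum_(b : bool) if b then A i (s i) else B i (s i)).
  by rewrite bigA_distr_bigA; apply: eq_bigr => h _; apply: eq_bigr => i _; rewrite mxE.
by apply: eq_bigr => i _; rewrite big_bool.
Qed.

(** * Values of [half_trig_poly] under shifts by [ipi] *)

Section HalfTrigPoly.
Variables (R : realType) (N : nat).
Implicit Types (p : 'I_N -> R[i]) (u : R[i]).

Lemma half_trig_polyD2ipi p u :
  half_trig_poly p (u + ipi + ipi) = (-1) ^+ N * half_trig_poly p u.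
Proof.
rewrite /half_trig_poly -[in (-1) ^+ N](card_ord N) -prodr_const -big_split /=.
apply: eq_bigr => j _; rewrite mulN1r -csinhDipi; congr csinh.
by rewrite -[in RHS](half_add ipi); ring.
Qed.

Lemma half_trig_poly_root p k : half_trig_poly p (p k) = 0.
Proof. by rewrite /half_trig_poly (bigD1 k) //= subrr mul0r csinh0 mul0r. Qed.

(** The double-angle formula in each factor. It lets Cauchy denominators be traded for values of
    [half_trig_poly]. *)
Lemma half_trig_poly_mul_ipi p u :
  half_trig_poly p u * half_trig_poly p (u + ipi) =
  (cexp (ipi / 2) / 2) ^+ N * \prod_j csinh (u - p j).
Proof.
rewrite /half_trig_poly -[in X in _ ^+ X](card_ord N) -prodr_const -!big_split /=.
apply: eq_bigr => j _; rewrite [csinh (u - p j)]csinh2.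
have -> : (u + ipi - p j) / 2 = (u - p j) / 2 + ipi / 2 by ring.
by rewrite csinhD_half; field.
Qed.

Lemma half_trig_poly_neq0 p u :
  (forall j, csinh (u - p j) != 0) ->
  half_trig_poly p u != 0 /\ half_trig_poly p (u + ipi) != 0.
Proof.
move=> up; apply/andP; rewrite -negb_or -mulf_eq0 half_trig_poly_mul_ipi.
rewrite mulf_neq0 ?expf_neq0 ?mulf_neq0 ?cexp_neq0 ?invr_eq0 ?pnatr_eq0 //.
exact/prodf_neq0.
Qed.

Lemma half_trig_half_trig_poly p a :
  half_trig N (fun u => half_trig_poly p (u + a)).
Proof.
apply: (half_trig_prod (f := fun j u => csinh ((u + a - p j) / 2))) => j.
apply: eq_half_trig (half_trig_csinh (a - p j)) => u.
by rewrite addrA.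
Qed.

End HalfTrigPoly.

(** * The scalar product as a ratio of Cauchy-type determinants *)

Section ScalarProduct.
Variables (R : realType) (N : nat) (eta : R[i]) (xi : 'I_N -> R[i]).

(** A zero of the first [csinh] would put [z] in the branch [k = 0] of [Xi], a zero of the second in
    the branch [k = -1]. *)
Lemma Xi_csinh_neq0 i z : ~ Xi eta xi i z ->
  csinh (xi i - z) != 0 /\ csinh (xi i - z - eta) != 0.
Proof.
move=> zXi; split; apply/eqP => /csinh_eq0[k zE]; apply: zXi.
  exists 0, (- k); split; first by left.
  by rewrite mulr0z mul0r addr0 mulrNz mulNr -zE; ring.
exists (-1), (- k); split; first by right.
by rewrite mulrN1z mulN1r mulrNz mulNr -zE; ring.
Qed.

(** A zero would make [xi i - a%:R * eta] a common point of the two sets. *)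
Lemma Xi_disjoint_csinh_neq0 (i j : 'I_N) (a b : bool) :
    Xi eta xi i `&` Xi eta xi j = set0 ->
  csinh (xi i - a%:R * eta - (xi j - b%:R * eta)) != 0.
Proof.
move=> ij0; apply/eqP => /csinh_eq0[k zE].
suff : set0 (xi i - a%:R * eta) by [].
rewrite -ij0; split.
  exists (- (a : nat)%:Z), 0; split; first by case: (a); [right | left].
  by rewrite mulr0z mul0r addr0 mulrNz mulNr.
exists (- (b : nat)%:Z), k; split; first by case: (b); [right | left].
by rewrite -zE mulrNz mulNr -pmulrn; ring.
Qed.

(** Only the diagonal pairs survive, and there the [Vdet] weight of the bra cancels the denominator
    in [bra_ket]. *)
Lemma sep_bra_ket (ket : bits N -> quantum_space R N)
    (bra : bits N -> dual_space R N)
    (bra_ket : forall h k : bits N,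
        bra h (ket k) = (h == k)%:R / Vdet (xish eta xi h))
    (V_neq0 : forall h : bits N, Vdet (xish eta xi h) != 0)
    (P Q : R[i] -> R[i]) (kappa kappa' : R[i]) (eps eps' : bool) :
  sep_bra eta xi bra P kappa eps (sep_ket eta xi ket Q kappa' eps') =
  Ssum eta xi (fun u => P u * Q u)
    ((-1) ^+ eps * (-1) ^+ eps' * kappa' / kappa).
Proof.
rewrite /sep_bra sum_lfunE; apply: eq_bigr => h _.
rewrite scale_lfunE /sep_ket linear_sum (bigD1 h) //=.
rewrite [X in _ *: (_ + X)]big1 => [|k kh].
  rewrite linearZ /= bra_ket eqxx addr0 /GRing.scale /=.
  set A := \prod_n _; set B := \prod_n _; set C := \prod_n _.
  have -> : C = A * B.
    rewrite -big_split; apply: eq_bigr => n _ /=; rewrite -exprMn.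
    by congr (_ ^+ _); rewrite invfM; ring.
  move: (V_neq0 h) (Vdet (xish eta xi (flip h)) / Vdet xi).
  by move: (Vdet (xish eta xi h)) => V V0 r; field.
by rewrite linearZ /= bra_ket eq_sym (negPf kh) mul0r scaler0.
Qed.

Lemma Ssum_detE (p q : 'I_N -> R[i]) (alpha : R[i]) :
  let P := half_trig_poly p in
  let Q := half_trig_poly q in
  let detC := \det (\matrix_(i < N, k < N) (1 / csinh (xi i - p k))) in
    (forall i k, csinh (xi i - p k) != 0) ->
    (forall i k, csinh (xi i - p k - eta) != 0) ->
    detC != 0 ->
  Ssum eta xi (fun u => P u * Q u) alpha =
  \det (\matrix_(i < N, k < N)
          (1 / csinh (xi i - p k)
           + alpha * ftilde eta P Q (xi i) / csinh (xi i - p k - eta))) / detC.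
Proof.
move=> P Q detC xp xpe C0.
have [c cE] := det_cauchy_csinh p.
have Cxi := cE xi xp; rewrite -/detC in Cxi.
have /mulf_neq0 : detC != 0 by []; move/(_ (\prod_i \prod_k csinh (xi i - p k))).
have PP0 : \prod_i \prod_k csinh (xi i - p k) != 0.
  by apply/prodf_neq0 => i _; apply/prodf_neq0.
(* Since [detC] is nonzero, so is [Vdet xi], a denominator of [Ssum]. *)
move/(_ PP0); rewrite Cxi mulf_eq0 negb_or => /andP[c0 V0].
apply: (mulIf C0); rewrite mulfVK // det_addmx_rows mulr_suml.
apply: eq_bigr => h _.
(* A true bit keeps the node [xi i], a false one moves it to [xi i - eta]: these are the nodes of
   [flip h]. *)
have xpf i k : csinh (xish eta xi (flip h) i - p k) != 0.
  rewrite /xish ffunE; case: (h i); rewrite ?mul0r ?subr0 // mul1r.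
  by rewrite addrAC.
have Cxh := cE _ xpf.
have -> : \matrix_(i, k) (if h i then 1 / csinh (xi i - p k) else
      alpha * ftilde eta P Q (xi i) / csinh (xi i - p k - eta)) =
    diag_mx (\row_i (alpha * ftilde eta P Q (xi i)) ^+ (1 - h i)) *m
    \matrix_(i, k) (1 / csinh (xish eta xi (flip h) i - p k)).
  apply/matrixP => i k; rewrite mul_diag_mx !mxE /xish ffunE.
  case: (h i); rewrite /= ?mul0r ?subr0 ?expr0 ?mul1r //.
  by rewrite expr1 [xi i - eta - _]addrAC.
rewrite det_mulmx det_diag.
have PPh0 : \prod_i \prod_k csinh (xish eta xi (flip h) i - p k) != 0.
  by apply/prodf_neq0 => i _; apply/prodf_neq0.
rewrite (canRL (mulfK PPh0) Cxh) (canRL (mulfK PP0) Cxi).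
set V1 := Vdet (xish _ _ _).
(* By [half_trig_poly_mul_ipi], the ratio of Cauchy denominators turns the [ipi]-shifted quotient of
   [P] in [ftilde] into the unshifted quotient of the weight. *)
have factorE : (\prod_n (alpha * (P (xi n) * Q (xi n)
      / (P (xi n - eta) * Q (xi n - eta)))) ^+ (1 - h n))
    * \prod_i \prod_k csinh (xish eta xi (flip h) i - p k) =
    \prod_i ((\row_i0 (alpha * ftilde eta P Q (xi i0)) ^+ (1 - h i0)) 0 i)
    * \prod_i \prod_k csinh (xi i - p k).
  rewrite -!big_split; apply: eq_bigr => n _ /=; rewrite mxE /xish ffunE.
  case: (h n); rewrite /= ?mul0r ?subr0 ?expr0 ?mul1r // !expr1.
  have [P0 P0'] := half_trig_poly_neq0 (xp n).
  have [|Pe0 Pe0'] := @half_trig_poly_neq0 R N p (xi n - eta).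
    by move=> j; rewrite addrAC.
  have e0 : (cexp (ipi / 2) / 2) ^+ N != 0 :> R[i].
    by rewrite expf_neq0 ?mulf_neq0 ?cexp_neq0 ?invr_eq0 ?pnatr_eq0.
  apply: (mulfI e0); rewrite mulrCA -half_trig_poly_mul_ipi.
  rewrite [RHS]mulrCA -half_trig_poly_mul_ipi /ftilde -/P -/Q.
  rewrite invfM; move: P0 P0' Pe0 Pe0'; rewrite -/P.
  move: (P (xi n)) (P (xi n + ipi)) (P (xi n - eta)) (P (xi n - eta + ipi))
    (Q (xi n)) (Q (xi n - eta))^-1 => a b c' d e f a0 b0 c0' d0; field.
  by rewrite b0 c0'.
rewrite (canRL (mulfK PP0) (esym factorE)).
move: PPh0 PP0 V0; move: (\prod_n _ ^+ _) (\prod_i \prod_k _)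
  (\prod_i \prod_k csinh (xi i - p k)) (Vdet xi) => A Ph Px V Ph0 Px0 V0.
by field; rewrite Ph0 V0 Px0.
Qed.

End ScalarProduct.

(** * The coth representation by sums of residues *)

Section CothRepresentation.
Variables (R : realType) (N : nat) (eta : R[i]) (xi p q : 'I_N -> R[i]).
Hypothesis xi_sep : forall i l, i != l -> csinh (xi i - xi l) != 0.
Hypothesis xip : forall i k, csinh (xi i - p k) != 0.
Hypothesis xip_eta : forall i k, csinh (xi i - p k - eta) != 0.
Hypothesis xiq : forall i j, csinh (xi i - q j) != 0.
Hypothesis xiq_eta : forall i j, csinh (xi i - q j - eta) != 0.
Hypothesis pq_sep : forall j k, csinh (p k - q j) != 0.

Let P := half_trig_poly p.
Let Q := half_trig_poly q.

Let P_D2ipi u : P (u + ipi + ipi) = (-1) ^+ N * P u.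
Proof. exact: half_trig_polyD2ipi. Qed.

(* [Qcosh j u] is [Q u * ccoth ((u - q j) / 2)] without its removable
   singularity. *)
Definition Qcosh (j : 'I_N) (u : R[i]) : R[i] :=
  \prod_l (if l == j then ccosh ((u - q l) / 2) else csinh ((u - q l) / 2)).

Lemma Qcosh_csinh j u :
  Qcosh j u * csinh ((u - q j) / 2) = Q u * ccosh ((u - q j) / 2).
Proof.
rewrite /Qcosh /Q /half_trig_poly (bigD1 j) //= [in RHS](bigD1 j) //= eqxx.
rewrite (eq_bigr (fun l => csinh ((u - q l) / 2))) => [|l /negPf -> //].
by ring.
Qed.

(** An entire form of [P (u + ipi) * Q (u - eta) * ccoth ((u - eta - q j) / 2)]. *)
Definition phi j (u : R[i]) : R[i] := P (u + ipi) * Qcosh j (u - eta).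

(** Divided by [csinh (u - q j - eta)], this is [P (u - eta + ipi) * Q u * ccoth ((u - q j - eta) /
    2)]; the squared [ccosh] removes the pole at [q j + eta + ipi]. *)
Definition psi j (u : R[i]) : R[i] :=
  P (u - eta + ipi) * Q u
  * (2 * (ccosh ((u - q j - eta) / 2) * ccosh ((u - q j - eta) / 2))).

Lemma half_trig_phi j : half_trig (N + N) (phi j).
Proof.
apply: half_trigM; first exact: half_trig_half_trig_poly.
apply: (half_trig_prod (f := fun l u => if l == j
  then ccosh ((u - eta - q l) / 2) else csinh ((u - eta - q l) / 2))) => l.
case: eqP => _.
  by apply: eq_half_trig (half_trig_ccosh (- eta - q l)) => u; rewrite addrA.
by apply: eq_half_trig (half_trig_csinh (- eta - q l)) => u; rewrite addrA.
Qed.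

Lemma half_trig_psi j : half_trig (N + N + 2) (psi j).
Proof.
have hc : half_trig 1 (fun u => ccosh ((u - q j - eta) / 2)).
  by apply: eq_half_trig (half_trig_ccosh (- q j - eta)) => u; rewrite addrA.
apply: half_trigM; last exact/half_trigZ/(half_trigM hc hc).
apply: half_trigM.
  apply: eq_half_trig (half_trig_half_trig_poly p (- eta + ipi)) => u.
  by rewrite addrA.
by apply: eq_half_trig (half_trig_half_trig_poly q 0) => u; rewrite addr0.
Qed.

(** Combined residues at [xi i] and [xi i + ipi], with the factor [1 / csinh (xi i - p k)] left out.
    The sign is that of [N.+1] factors [csinh], the pole at [p k] being counted. *)
Definition Xmat : 'M[R[i]]_N := \matrix_(j, i)
  ((phi j (xi i) + (-1) ^+ N.+1 * phi j (xi i + ipi))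
   / \prod_(l | l != i) csinh (xi i - xi l)).

Let xi_prod_neq0 i : \prod_(l | l != i) csinh (xi i - xi l) != 0.
Proof. by apply/prodf_neq0 => l li; rewrite xi_sep // eq_sym. Qed.

Let csinh_opp (z w : R[i]) : csinh (z - w) != 0 -> csinh (w - z) != 0.
Proof. by rewrite -(opprB z w) csinhN oppr_eq0. Qed.

(** Residues of [phi j] at the [xi i] and [p k], modulo [ipi]. The one at [p k + ipi] vanishes
    because [p k] is a root of [P]. *)
Lemma Xmat_cauchy j k :
  \sum_i Xmat j i / csinh (xi i - p k) = - (phi j (p k) / dfun xi (p k)).
Proof.
pose y (o : option 'I_N) := if o is Some i then xi i else p k.
have y_sep s t : s != t -> csinh (y s - y t) != 0.
  case: s t => [i|] [l|] //= st; [exact: xi_sep | exact/csinh_opp/xip].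
have := sum_residues y_sep (half_trig_phi j).
rewrite card_option card_ord addnn doubleS => /(_ erefl).
rewrite big_option /= big_option_neqNone /= => /eqP; rewrite addr_eq0 => /eqP e.
apply: oppr_inj; rewrite opprK /dfun; transitivity
  ((phi j (p k) + (-1) ^+ N.+1 * phi j (p k + ipi)) / \prod_l csinh (p k - xi l)).
  rewrite e; congr (- _); apply: eq_bigr => i _.
  rewrite big_option_neq /= mxE; move: (phi j (xi i) + _) => A.
  move: (csinh (xi i - p k)) => s; by rewrite [in RHS]invfM [in RHS]mulrA mulrAC.
congr (_ / _); rewrite /phi P_D2ipi /P half_trig_poly_root.
by rewrite mulr0 mul0r mulr0 addr0.
Qed.

Hypothesis PQ_quasi_periodic : forall n : 'I_N,
  P (xi n - eta) * Q (xi n - eta) / (P (xi n) * Q (xi n)) =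
  P (xi n - eta + ipi) * Q (xi n - eta + ipi) / (P (xi n + ipi) * Q (xi n + ipi)).

(** [ftilde] exchanges the shift by [eta] between [P] and [Q], at [xi i] by definition ([f1]) and at
    [xi i + ipi] by quasi-periodicity ([f2]). One more [csinh], antiperiodic under [ipi], accounts
    for the change of sign exponent. *)
Lemma phi_ftilde j i :
  (phi j (xi i) + (-1) ^+ N.+1 * phi j (xi i + ipi)) * ftilde eta P Q (xi i)
    * csinh (xi i - q j - eta) =
  psi j (xi i) + (-1) ^+ N.+2 * psi j (xi i + ipi).
Proof.
have [P0 P0'] := half_trig_poly_neq0 (xip i).
have [Q0 Q0'] := half_trig_poly_neq0 (xiq i).
have [|Pe0 Pe0'] := @half_trig_poly_neq0 R N p (xi i - eta).
  by move=> k; rewrite addrAC.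
have [|Qe0 Qe0'] := @half_trig_poly_neq0 R N q (xi i - eta).
  by move=> k; rewrite addrAC.
rewrite -/P -/Q in P0 P0' Q0 Q0' Pe0 Pe0' Qe0 Qe0'.
have f1 : ftilde eta P Q (xi i) * P (xi i + ipi) * Q (xi i - eta) =
          P (xi i - eta + ipi) * Q (xi i).
  by rewrite /ftilde; field; rewrite P0' Qe0.
have f2 : ftilde eta P Q (xi i) * P (xi i) * Q (xi i - eta + ipi) =
          P (xi i - eta) * Q (xi i + ipi).
  have e : P (xi i - eta) * Q (xi i - eta) * (P (xi i + ipi) * Q (xi i + ipi)) =
           P (xi i - eta + ipi) * Q (xi i - eta + ipi) * (P (xi i) * Q (xi i)).
    have /eqP := PQ_quasi_periodic i.
    by rewrite eqr_div ?mulf_neq0 // => /eqP.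
  apply: (mulIf (mulf_neq0 P0' Qe0)).
  transitivity (P (xi i - eta + ipi) * Q (xi i - eta + ipi) * (P (xi i) * Q (xi i))).
    by rewrite /ftilde; field; rewrite P0' Qe0.
  by rewrite -e; ring.
set w := (xi i - q j - eta) / 2.
have wE : (xi i - eta - q j) / 2 = w by rewrite /w; ring.
have wiE : (xi i + ipi - eta - q j) / 2 = w + ipi / 2 by rewrite /w; ring.
have wiE' : (xi i + ipi - q j - eta) / 2 = w + ipi / 2 by rewrite /w; ring.
have e2 : cexp (ipi / 2) ^+ 2 = -1 :> R[i] by rewrite cexp_half cexp_ipi.
have c1 := Qcosh_csinh j (xi i - eta); rewrite wE in c1.
(* After the shift by [ipi] the half-angle coth has become a tanh. *)
have c2 : Qcosh j (xi i + ipi - eta) * ccosh w = Q (xi i - eta + ipi) * csinh w.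
  have := Qcosh_csinh j (xi i + ipi - eta); rewrite wiE csinhD_half ccoshD_half.
  rewrite [xi i + ipi - eta]addrAC => c2.
  by apply: (mulfI (cexp_neq0 (ipi / 2))); rewrite mulrCA c2; ring.
rewrite /phi /psi P_D2ipi [csinh (xi i - _ - _)]csinh2 -/w wiE'.
have -> : P (xi i + ipi - eta + ipi) = (-1) ^+ N * P (xi i - eta).
  by rewrite [xi i + ipi - eta]addrAC P_D2ipi.
rewrite ccoshD_half -/P -/Q.
move: f1 f2 c1 c2 e2; move: (ftilde _ _ _ _) (cexp (ipi / 2)) (csinh w) (ccosh w).
move: (Qcosh _ _) (Qcosh _ _) (P (xi i + ipi)) (P (xi i)) (P (xi i - eta)).
move: (P (xi i - eta + ipi)) (Q (xi i)) (Q (xi i + ipi)) (Q (xi i - eta)).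
move: (Q (xi i - eta + ipi)) => Qei Qe Qi Q' Pei Pe P' Pi q1 q2 f e s c.
move=> f1 f2 c1 c2 e2; rewrite !exprS.
transitivity (f * Pi * (P' * s) * (2 * c)
  - (-1) ^+ N * (-1) ^+ N * (f * q1) * (Pe * c) * (2 * s)); first by ring.
rewrite c1 c2.
transitivity (f * Pi * Pei * (2 * c * c)
  - (-1) ^+ N * (-1) ^+ N * (f * q1 * Qei) * (2 * s * s)); first by ring.
rewrite f1 f2.
transitivity (Qe * Qi * (2 * c * c)
  + e ^+ 2 * ((-1) ^+ N * (-1) ^+ N * (q2 * Q') * (2 * s * s))); last by ring.
by rewrite e2; ring.
Qed.

Let ccosh0 : ccosh 0 = 1 :> R[i].
Proof. by rewrite /ccosh oppr0 cexp0; field. Qed.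

(** Residues of [psi j] at the [xi i], [p k + eta] and [q j + eta], modulo [ipi]: by [phi_ftilde]
    those at the [xi i] form the left-hand side. *)
Lemma Xmat_cauchy_eta j k :
  \sum_i Xmat j i * ftilde eta P Q (xi i) / csinh (xi i - p k - eta) =
  - (psi j (p k + eta) / (csinh (p k - q j) * dfun xi (p k + eta))
     + psi j (q j + eta) / (csinh (q j - p k) * dfun xi (q j + eta))).
Proof.
pose y (o : option (option 'I_N)) :=
  if o is Some o' then (if o' is Some i then xi i else q j + eta) else p k + eta.
have qp : csinh (q j - p k) != 0 by apply/csinh_opp/pq_sep.
have cancel_eta (z w : R[i]) : z + eta - (w + eta) = z - w by ring.
have subD_eta (z w : R[i]) : z - (w + eta) = z - w - eta by ring.
have y_sep s t : s != t -> csinh (y s - y t) != 0.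
  case: s t => [[i|]|] [[l|]|] //= st; rewrite ?cancel_eta //.
  - exact: xi_sep.
  - by rewrite subD_eta.
  - by rewrite subD_eta.
  - by apply: csinh_opp; rewrite subD_eta.
  - by apply: csinh_opp; rewrite subD_eta.
have := sum_residues y_sep (half_trig_psi j).
rewrite !card_option card_ord addnn addn2 !doubleS => /(_ erefl).
rewrite !big_option /= addrA !big_option_neqNone /= big_option big_option_neq.
rewrite big_option_neqNone /= !cancel_eta => /eqP; rewrite addr_eq0 => /eqP e.
have p0 : psi j (p k + eta + ipi) = 0.
  rewrite /psi (_ : p k + eta + ipi - eta + ipi = p k + ipi + ipi); last by ring.
  by rewrite P_D2ipi /P half_trig_poly_root mulr0 !mul0r.
have q0 : psi j (q j + eta + ipi) = 0.
  rewrite /psi (_ : (q j + eta + ipi - q j - eta) / 2 = 0 + ipi / 2); last by ring.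
  by rewrite ccoshD_half csinh0 !mulr0.
rewrite p0 q0 !mulr0 !addr0 in e.
rewrite /dfun e opprK; apply: eq_bigr => i _.
rewrite -phi_ftilde !big_option_neq /= !subD_eta mxE.
move: (xi_prod_neq0 i) (xiq_eta i j) (xip_eta i k); move: (phi j (xi i) + _) => A.
move: (csinh _) (csinh _) (\prod_(l | l != i) _) => a b D D0 b0 a0.
by field; rewrite D0 b0 a0.
Qed.

(** What remains of the residue in [Xmat_cauchy] once the coth is removed: it no longer depends on
    [j], so it is a column factor. *)
Let cfac k := - (Q (p k - eta) * P (p k + ipi) / dfun xi (p k)).

Hypothesis P_neq0 : forall k, P (p k + ipi) != 0.
Hypothesis Q_neq0 : forall k, Q (p k - eta) != 0.
Hypothesis pq_half : forall j k, csinh ((p k - q j) / 2) != 0.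
Hypothesis pq_half_eta : forall j k, csinh ((p k - q j - eta) / 2) != 0.

Let dfun_neq0 k : dfun xi (p k) != 0.
Proof. by apply/prodf_neq0 => n _; apply: csinh_opp. Qed.

Let afun_dfun u : afun eta xi u = dfun xi (u + eta).
Proof. by apply: eq_bigr => n _; rewrite addrAC. Qed.

Let Xmat_cauchy_coth j k : \sum_i Xmat j i / csinh (xi i - p k) =
  ccoth ((p k - q j - eta) / 2) * cfac k.
Proof.
rewrite Xmat_cauchy /cfac /phi /ccoth mulrN; congr (- _).
have := Qcosh_csinh j (p k - eta); rewrite [p k - eta - q j]addrAC.
move: (pq_half_eta j k) (dfun_neq0 k).
move: (csinh _) (ccosh _) (Qcosh _ _) (dfun _ _) (Q _) (P _) => s c qc d qe pp.
by move=> s0 d0 e; rewrite (canRL (mulfK s0) e); field; rewrite s0 d0.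
Qed.

Let mulmx_Xmat_cauchy :
  Xmat *m \matrix_(i, k) (1 / csinh (xi i - p k)) =
  \matrix_(j, k) ccoth ((p k - q j - eta) / 2) *m diag_mx (\row_k cfac k).
Proof.
apply/matrixP => j k; rewrite mul_mx_diag !mxE -Xmat_cauchy_coth.
by apply: eq_bigr => i _; rewrite !mxE div1r.
Qed.

(** The residue at [p k + eta] gives the [afrak] term of [Smat], the one at [q j + eta] the last
    term, whose 2 survives because [ccosh 0 = 1]. *)
Let mulmx_Xmat_Smat alpha :
  Xmat *m \matrix_(i, k) (1 / csinh (xi i - p k)
     + alpha * ftilde eta P Q (xi i) / csinh (xi i - p k - eta)) =
  Smat eta xi alpha q p *m diag_mx (\row_k cfac k).
Proof.
apply/matrixP => j k; rewrite mul_mx_diag !mxE.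
transitivity (\sum_i Xmat j i / csinh (xi i - p k) + alpha *
   \sum_i Xmat j i * ftilde eta P Q (xi i) / csinh (xi i - p k - eta)).
  rewrite mulr_sumr -big_split; apply: eq_bigr => i _ /=; rewrite [X in _ * X]mxE.
  move: (Xmat j i) (csinh _)^-1 (csinh _)^-1 (ftilde _ _ _ _) => x a b f.
  by ring.
rewrite Xmat_cauchy_coth Xmat_cauchy_eta /afrak !afun_dfun -/P -/Q.
have dfun_eta z : (forall n, csinh (xi n - z - eta) != 0) -> dfun xi (z + eta) != 0.
  move=> hz; apply/prodf_neq0 => n _; apply: csinh_opp.
  by rewrite (_ : xi n - (z + eta) = xi n - z - eta) //; ring.
have dp0 := dfun_eta _ (fun n => xip_eta n k); have dq0 := dfun_eta _ (fun n => xiq_eta n j).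
rewrite /psi !addrK (_ : q j + eta - q j - eta = 0); last by ring.
rewrite (_ : p k + eta - q j - eta = p k - q j); last by ring.
rewrite mul0r ccosh0 -(opprB (p k) (q j)) csinhN.
have s0 := pq_sep j k; rewrite csinh2 in s0 *.
have ch0 : ccosh ((p k - q j) / 2) != 0.
  by apply/eqP => c0; rewrite c0 mulr0 eqxx in s0.
move: (P_neq0 k) (Q_neq0 k) (dfun_neq0 k) dp0 dq0 (pq_half j k) ch0 {s0}.
rewrite /ccoth /cfac; move: (csinh ((p k - q j) / 2)) (ccosh ((p k - q j) / 2)).
move: (ccosh (_ / 2) / csinh (_ / 2)) => ce s c.
move: (dfun _ _) (dfun _ _) (dfun _ _) (P _) (P _) (Q _) (Q _) (Q _).
move=> d d0 d1 P0 P1 Q0 Q1 Q2 P1n Q2n d1n d0n dn sn cn; field.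
by rewrite d1n cn d0n sn dn P1n Q2n.
Qed.

(** The factors [Xmat] and [cfac] common to both matrix identities cancel in the quotient. That
    [Xmat] and the Cauchy matrix are invertible is read off from the first identity and
    [detcoth != 0]. *)
Lemma det_Smat alpha :
  let detC := \det (\matrix_(i < N, k < N) (1 / csinh (xi i - p k))) in
  let detcoth := \det (\matrix_(j < N, k < N) ccoth ((p k - q j - eta) / 2)) in
    detcoth != 0 ->
  detC != 0 /\
  \det (\matrix_(i < N, k < N)
     (1 / csinh (xi i - p k)
      + alpha * ftilde eta P Q (xi i) / csinh (xi i - p k - eta))) / detC =
  \det (Smat eta xi alpha q p) / detcoth.
Proof.
move=> detC detcoth coth0.
have /(congr1 determinant) := mulmx_Xmat_cauchy.
have /(congr1 determinant) := mulmx_Xmat_Smat alpha.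
rewrite !det_mulmx -/detC -/detcoth.
have : \det (diag_mx (\row_k cfac k)) != 0.
  rewrite det_diag; apply/prodf_neq0 => k _; rewrite mxE oppr_eq0.
  by rewrite !mulf_neq0 ?invr_eq0.
move: (\det (diag_mx _)) => c c0 detXM detXC.
have : \det Xmat * detC != 0 by rewrite detXC mulf_neq0.
rewrite mulf_eq0 negb_or => /andP[X0 C0]; split=> //.
apply/eqP; rewrite eqr_div //; apply/eqP/(mulfI (mulf_neq0 X0 c0)).
transitivity (\det Xmat * \det (\matrix_(i < N, k < N)
     (1 / csinh (xi i - p k)
      + alpha * ftilde eta P Q (xi i) / csinh (xi i - p k - eta)))
   * (detcoth * c)); first by ring.
by rewrite detXM -detXC; ring.
Qed.

End CothRepresentation.

(** * Both determinant representations, and the product form of the coth determinant *)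

Theorem proposition4p1 (R : realType) (N : nat) (N_gt0 : (0 < N)%N)
    (eta : R[i]) (eta_incomm : ~ commensurate_ipi eta)
    (xi : 'I_N -> R[i])
    (Xi_disj : forall i j : 'I_N, i != j -> Xi eta xi i `&` Xi eta xi j = set0)
    (ket : bits N -> quantum_space R N) (bra : bits N -> dual_space R N)
    (ket_basis : basis_of fullv [seq ket h | h <- enum {: bits N}])
    (bra_basis : basis_of fullv [seq bra h | h <- enum {: bits N}])
    (bra_ket : forall h k : bits N,
        bra h (ket k) = (h == k)%:R / Vdet (xish eta xi h))
    (p q : 'I_N -> R[i])
    (p_notin_Xi : forall i j : 'I_N, ~ Xi eta xi i (p j))
    (q_notin_Xi : forall i j : 'I_N, ~ Xi eta xi i (q j))
    (p_inj : injective p) (q_inj : injective q)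
    (pq_neq : forall i j : 'I_N, p i <> q j)
    (kappa kappa' : R[i]) (kappa_neq0 : kappa != 0) (kappa'_neq0 : kappa' != 0)
    (eps eps' : bool) :
  let P := half_trig_poly p in
  let Q := half_trig_poly q in
  let PQ := fun u : R[i] => P u * Q u in
  let alpha := (-1) ^+ eps * (-1) ^+ eps' * kappa' / kappa in
  let S := Ssum eta xi PQ alpha in
  let detC := \det (\matrix_(i < N, k < N) (1 / csinh (xi i - p k))) in
  let detS := \det (Smat eta xi alpha q p) in
  let detcoth := \det (\matrix_(j < N, k < N) ccoth ((p k - q j - eta) / 2)) in
  let den :=
    ccosh ((\sum_(l < N) (p l - q l) - N%:R * eta) / 2)
    * \prod_(i < N) \prod_(j < N | (i < j)%N)
        (csinh ((p i - p j) / 2) * csinh ((q j - q i) / 2)) in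
  [/\ sep_bra eta xi bra P kappa eps (sep_ket eta xi ket Q kappa' eps') = S,
      detC != 0 ->
      S = \det (\matrix_(i < N, k < N)
                  (1 / csinh (xi i - p k)
                   + alpha * ftilde eta P Q (xi i) / csinh (xi i - p k - eta)))
          / detC
    & (forall n : 'I_N, PQ (xi n - eta) / PQ (xi n)
                        = PQ (xi n - eta + ipi) / PQ (xi n + ipi)) ->
      (forall k : 'I_N, P (p k + ipi) != 0) ->
      (forall k : 'I_N, Q (p k - eta) != 0) ->
      (forall j k : 'I_N, csinh (p k - q j) != 0) ->
      (forall j k : 'I_N, csinh ((p k - q j) / 2) != 0) ->
      (forall j k : 'I_N, csinh ((p k - q j - eta) / 2) != 0) ->
      detcoth != 0 ->
      den != 0 ->
      S = detS / detcoth
      /\ S = (\prod_(i < N) \prod_(j < N) csinh ((p i - q j - eta) / 2)) * detS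
             / den].
Proof.
move=> P Q PQ alpha S detC detS detcoth den.
have xi_sep i l : i != l -> csinh (xi i - xi l) != 0.
  by move=> /Xi_disj /(Xi_disjoint_csinh_neq0 false false); rewrite mul0r !subr0.
have xip i k := (Xi_csinh_neq0 (p_notin_Xi i k)).1.
have xip_eta i k := (Xi_csinh_neq0 (p_notin_Xi i k)).2.
have xiq i k := (Xi_csinh_neq0 (q_notin_Xi i k)).1.
have xiq_eta i k := (Xi_csinh_neq0 (q_notin_Xi i k)).2.
split.
- apply: sep_bra_ket => // h; apply/prodf_neq0 => i _; apply/prodf_neq0 => j ij.
  by apply/Xi_disjoint_csinh_neq0/Xi_disj; rewrite -val_eqE gtn_eqF.
- exact: Ssum_detE.
move=> PQ_qp P0 Q0 pq_sep pq_half pq_half_eta coth0 den0.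
have quasi n : P (xi n - eta) * Q (xi n - eta) / (P (xi n) * Q (xi n)) =
    P (xi n - eta + ipi) * Q (xi n - eta + ipi) / (P (xi n + ipi) * Q (xi n + ipi)).
  exact: PQ_qp.
have [C0 detE] := det_Smat xi_sep xip xip_eta xiq xiq_eta pq_sep quasi
  P0 Q0 pq_half pq_half_eta alpha coth0.
have SE : S = detS / detcoth by rewrite -detE; exact: Ssum_detE.
split=> //; rewrite SE.
have prod0 : \prod_(i < N) \prod_(j < N) csinh ((p i - q j - eta) / 2) != 0.
  by apply/prodf_neq0 => i _; apply/prodf_neq0.
(* Putting [eta] into [y] makes every [x i - y j] the argument of a coth entry. *)
pose x i : R[i] := p i / 2; pose y i : R[i] := (q i + eta) / 2.
have xyE i j : x i - y j = (p i - q j - eta) / 2 by rewrite /x /y; ring.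
have cothE : detcoth * \prod_(i < N) \prod_(j < N) csinh ((p i - q j - eta) / 2) = den.
  have := @det_ccoth R N x y N_gt0.
  (* In [det_ccoth] the rows follow [x], that is [p]; in [detcoth] they follow [q]. *)
  rewrite (_ : \matrix_(k, j) _ = (\matrix_(j, k) ccoth ((p k - q j - eta) / 2))^T);
    last by apply/matrixP => k j; rewrite !mxE xyE.
  rewrite det_tr -/detcoth (eq_bigr (fun i => \prod_j csinh ((p i - q j - eta) / 2)));
    last by move=> i _; apply: eq_bigr => j _; rewrite xyE.
  move=> ->.
  - congr (_ * _).
      congr ccosh; rewrite -sumrB mulrBl -mulrA mulr_suml.
      rewrite (_ : N%:R * (eta / 2) = \sum_(l < N) (eta / 2)); last first.
        by rewrite sumr_const card_ord mulr_natl.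
      by rewrite -sumrB; apply: eq_bigr => l _; rewrite xyE; ring.
    apply: eq_bigr => i _; apply: eq_bigr => j _.
    by congr (csinh _ * csinh _); rewrite /x /y; ring.
  - by move=> i j; rewrite xyE.
  (* The separation of the [y j] is contained in [den != 0]. *)
  - move=> i j ij; move: den0; rewrite mulf_eq0 negb_or => /andP[_].
    move=> /prodf_neq0/(_ i isT)/prodf_neq0/(_ j ij).
    rewrite mulf_eq0 negb_or => /andP[_].
    by rewrite (_ : y j - y i = (q j - q i) / 2) // /y; ring.
rewrite -cothE; field.
by rewrite prod0 coth0.
Qed.
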